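(* Let $A$ be a real $3\times 3$ symmetric matrix and let $\alpha$ be an eigenvalue of $A$. Let $C=A-\alpha I$, where $I$ is the $3\times 3$ identity matrix. (i) If $C$ is the zero matrix, then $\{(1,0,0)^T,(0,1,0)^T,(0,0,1)^T\}$ is an orthonormal set of eigenvectors of $A$ that spans the eigenspace of $A$ corresponding to $\alpha$ (the eigenspace is all of $\mathbb{R}^3$). (ii) Otherwise, let $c_1,c_2,c_3$ be the column vectors of $C$, and let $v_1=c_1\times c_2$, $v_2=c_2\times c_3$, $v_3=c_3\times c_1$. If one or more of the vectors $v_1,v_2,v_3$ is not $(0,0,0)^T$, let $v$ be one such vector and let $\hat v=v/\|v\|$. Then $\{\hat v\}$ is an orthonormal set of eigenvectors of $A$ (one eigenvector) that spans the eigenspace of $A$ corresponding to $\alpha$. (iii) Otherwise, if $C$ is not the zero matrix and all of $c_1\times c_2$, $c_2\times c_3$, $c_3\times c_1$ equal $(0,0,0)^T$, let $u=(u_1,u_2,u_3)^T$ be one of $c_1,c_2,c_3$ that is not $(0,0,0)^T$, let $k=\arg\max_j\{|u_j|,\ j=1,2,3\}$, and let $w$ be the vector obtained from $(1,1,1)^T$ by replacing its $k$-th coordinate with $0$. Let $v_1=u\times w$ and $\hat v_1=v_1/\|v_1\|$, and let $v_2=v_1\times u$ and $\hat v_2=v_2/\|v_2\|$. Then $\{\hat v_1,\hat v_2\}$ is an orthonormal set of eigenvectors of $A$ that spans the eigenspace of $A$ corresponding to $\alpha$ ($\alpha$ is of multiplicity two).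
   Context: $\times$ denotes the cross product in $\mathbb{R}^3$ and $\|\cdot\|$ the Euclidean norm. In (iii), $v_1$ and $v_2$ are redefined as indicated. If the maximum defining $k$ is attained at several indices, $k$ may be any one of them. *)

(* Defs.v *)
From mathcomp Require Import all_boot all_order all_algebra.
From mathcomp Require Import reals.

Set Implicit Arguments.
Unset Strict Implicit.
Unset Printing Implicit Defensive.

Import Order.TTheory GRing.Theory Num.Theory.
Import passmx.
Local Open Scope ring_scope.

(* Coordinates and columns are numbered 0, 1, 2 (elements of 'I_3). *)

Definition col3 (R : nzRingType) (a b c : R) : 'cV[R]_3 :=
  \col_(i < 3) [:: a; b; c]`_i.

Definition cross (R : nzRingType) (x y : 'cV[R]_3) : 'cV[R]_3 :=
  col3 (x 1 0 * y 2 0 - x 2 0 * y 1 0)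
       (x 2 0 * y 0 0 - x 0 0 * y 2 0)
       (x 0 0 * y 1 0 - x 1 0 * y 0 0).

Definition dot (R : nzRingType) (x y : 'cV[R]_3) : R :=
  \sum_(i < 3) x i 0 * y i 0.

(* The norm that MathComp-Analysis puts on matrices is the sup norm, hence
   this separate Euclidean one. *)
Definition enorm (R : rcfType) (x : 'cV[R]_3) : R := Num.sqrt (dot x x).

Definition normalize (R : rcfType) (x : 'cV[R]_3) : 'cV[R]_3 :=
  (enorm x)^-1 *: x.

(* Finite sets of vectors are given by sequences; an orthonormal sequence has
   no repetition since a vector of norm 1 is not orthogonal to itself. *)
Definition orthonormal (R : rcfType) (s : seq 'cV[R]_3) : bool :=
  all (fun x => enorm x == 1) s && pairwise (fun x y => dot x y == 0) s.

(* eigenvalue and eigenspace of mxalgebra are about row vectors (x *m A);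
   here matrices act on column vectors. *)
Definition mxend (R : fieldType) (A : 'M[R]_3) : 'End('cV[R]_3) :=
  linfun (mulmx A).

Definition is_eigenvector (R : fieldType) (A : 'M[R]_3) (x : 'cV[R]_3) : Prop :=
  x != 0 /\ exists a : R, A *m x = a *: x.

Definition orthonormal_eigenbasis (R : rcfType) (A : 'M[R]_3) (alpha : R)
    (s : seq 'cV[R]_3) : Prop :=
  [/\ orthonormal s,
      {in s, forall x, is_eigenvector A x}
    & <<s>>%VS = leigenspace (mxend A) alpha].

(* Main.v *)
Require Import Defs.
From mathcomp Require Import all_boot all_order all_algebra.
From mathcomp Require Import reals.
From mathcomp Require Import ring.

Set Implicit Arguments.
Unset Strict Implicit.
Unset Printing Implicit Defensive.

Import Order.TTheory GRing.Theory Num.Theory.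
Import passmx.
Local Open Scope ring_scope.

(** Since C = A - alpha I is symmetric, a vector x lies in the eigenspace of A
    for alpha, that is in the kernel of C, exactly when it is orthogonal to the
    three columns of C ([sym_ker_dotP]).

    If C = 0, every vector qualifies, and the standard basis does the job.

    If v = cross ci cj is nonzero for two columns of C, every x in the kernel is
    orthogonal to ci and cj, so the triple product formula gives cross x v = 0:
    the kernel lies on the line of v.  The kernel contains some nonzero x because
    alpha is an eigenvalue, and v is then a multiple of that x, so v itself is
    in the kernel ([eigenbasis_cross]).

    If all the products of columns vanish, the columns are multiples of any
    nonzero one u among them, so the kernel is the plane orthogonal to u
    ([parallel_cols_ker]).  The vector w vanishes at the coordinate k, where u
    does not, so u and w are independent and v1 = cross u w is a nonzero vector of
    that plane ([cross_argmax_neq0]); v1 and cross v1 u form an orthogonal basis of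
    it ([complement_eigenbasis]).  The coordinates of the products of columns
    are, up to sign, the 2 x 2 minors of C; as they vanish, the characteristic polynomial of
    A is (X - alpha)^2 (X - alpha - tr C) ([char_poly_rank1]).  The same minors
    show that (tr C)^2 is the sum of the squared entries of C, so tr C <> 0
    ([trace_rank1_neq0]) and the multiplicity of alpha is exactly two.

    In all three cases the spanning property is obtained in the form of a
    Fourier expansion of the kernel vectors ([fourier_eigenbasis]). *)

(** * Sums, vectors and determinants in dimension three *)

Lemma ord3P (P : 'I_3 -> Prop) : P 0 -> P 1 -> P 2 -> forall i, P i.
Proof.
move=> P0 P1 P2 [[|[|[|//]]] lt_i].
- by rewrite (_ : Ordinal _ = 0) //; apply: val_inj.
- by rewrite (_ : Ordinal _ = 1) //; apply: val_inj.
- by rewrite (_ : Ordinal _ = 2) //; apply: val_inj.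
Qed.

Lemma big_ord3 (V : nmodType) (F : 'I_3 -> V) :
  \sum_(i < 3) F i = F 0 + F 1 + F 2.
Proof.
rewrite !big_ord_recl big_ord0 addr0 addrA.
by congr (_ + F _ + F _); apply: val_inj.
Qed.

Lemma det3 (R : comNzRingType) (M : 'M[R]_3) :
  \det M = M 0 0 * (M 1 1 * M 2 2 - M 1 2 * M 2 1)
         - M 0 1 * (M 1 0 * M 2 2 - M 1 2 * M 2 0)
         + M 0 2 * (M 1 0 * M 2 1 - M 1 1 * M 2 0).
Proof.
(* Entries indexed by natural numbers let the indices of the minors compute. *)
pose m (i j : nat) := M (inord i) (inord j).
have -> : M = \matrix_(i, j) m i j.
  by apply/matrixP => i j; rewrite mxE /m !inord_val.
rewrite (expand_det_row _ 0) !big_ord_recl big_ord0 /cofactor.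
rewrite !(expand_det_row _ 0) !big_ord_recl !big_ord0 /cofactor !det_mx11 !mxE.
rewrite /= /bump /= !(addn0, add0n, addn1, add1n) !expr0 !expr1 !expr2.
ring.
Qed.

(** * Dot and cross products over a commutative ring *)

Section CrossProduct.
Variable R : comNzRingType.
Implicit Types (x y z : 'cV[R]_3) (C : 'M[R]_3).

Lemma eq_cV3 x y :
  x 0 0 = y 0 0 -> x 1 0 = y 1 0 -> x 2 0 = y 2 0 -> x = y.
Proof.
move=> e0 e1 e2; apply/matrixP => i j; rewrite (ord1 j).
by elim/ord3P: i.
Qed.

Lemma dotE x y : dot x y = x 0 0 * y 0 0 + x 1 0 * y 1 0 + x 2 0 * y 2 0.
Proof. exact: big_ord3. Qed.

Lemma crossE x y :
  [/\ cross x y 0 0 = x 1 0 * y 2 0 - x 2 0 * y 1 0,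
      cross x y 1 0 = x 2 0 * y 0 0 - x 0 0 * y 2 0 &
      cross x y 2 0 = x 0 0 * y 1 0 - x 1 0 * y 0 0].
Proof. by rewrite /cross /col3 !mxE. Qed.

Lemma dotC x y : dot x y = dot y x.
Proof. by apply: eq_bigr => i _; rewrite mulrC. Qed.

Lemma dotZl a x y : dot (a *: x) y = a * dot x y.
Proof. by rewrite !dotE !mxE; ring. Qed.

Lemma dotZr a x y : dot x (a *: y) = a * dot x y.
Proof. by rewrite !dotE !mxE; ring. Qed.

Lemma dotBl x y z : dot (x - y) z = dot x z - dot y z.
Proof. by rewrite !dotE !mxE; ring. Qed.

Lemma dot0l x : dot 0 x = 0.
Proof. by rewrite dotE !mxE; ring. Qed.

Lemma dot_crossl x y : dot x (cross x y) = 0.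
Proof. by case: (crossE x y) => e0 e1 e2; rewrite dotE e0 e1 e2; ring. Qed.

Lemma dot_crossr x y : dot y (cross x y) = 0.
Proof. by case: (crossE x y) => e0 e1 e2; rewrite dotE e0 e1 e2; ring. Qed.

Lemma crossxx x : cross x x = 0.
Proof.
by case: (crossE x x) => e0 e1 e2; apply: eq_cV3; rewrite ?e0 ?e1 ?e2 mxE; ring.
Qed.

Lemma crossx0 x : cross x 0 = 0.
Proof.
by case: (crossE x 0) => e0 e1 e2; apply: eq_cV3; rewrite ?e0 ?e1 ?e2 !mxE; ring.
Qed.

Lemma crossN x y : cross y x = - cross x y.
Proof.
case: (crossE x y) (crossE y x) => [e0 e1 e2] [f0 f1 f2].
by apply: eq_cV3; rewrite ?f0 ?f1 ?f2 mxE ?e0 ?e1 ?e2; ring.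
Qed.

Lemma triple_cross x y z :
  cross x (cross y z) = dot x z *: y - dot x y *: z.
Proof.
case: (crossE y z) (crossE x (cross y z)) => [e0 e1 e2] [f0 f1 f2].
by apply: eq_cV3; rewrite ?f0 ?f1 ?f2 ?e0 ?e1 ?e2 !mxE !dotE; ring.
Qed.

Lemma dot_cross_cross x y :
  dot (cross x y) (cross x y) = dot x x * dot y y - dot x y ^+ 2.
Proof.
by case: (crossE x y) => e0 e1 e2; rewrite !dotE e0 e1 e2 expr2; ring.
Qed.

(** When y has an invertible square dot y y, this exhibits x as a multiple of
    y.  It is the triple product formula for y, x and y. *)
Lemma parallel_cross0 x y : cross x y = 0 -> dot y y *: x = dot y x *: y.
Proof.
move=> xy0; apply/eqP; rewrite -subr_eq0 -triple_cross xy0.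
by rewrite crossx0.
Qed.

(** * Kernels of symmetric matrices and vanishing minors *)

(** By symmetry the columns of C are also its rows. *)
Lemma sym_ker_dotP C x : C^T = C ->
  C *m x = 0 <-> forall i, dot (col i C) x = 0.
Proof.
move=> symC; have Cx i : (C *m x) i 0 = dot (col i C) x.
  by rewrite mxE; apply: eq_bigr => j _; rewrite -[in LHS]symC !mxE.
split=> [Cx0 i | C0]; first by rewrite -Cx Cx0 mxE.
by apply: eq_cV3; rewrite Cx C0 mxE.
Qed.

Lemma cross_cols0 C : cross (col 0 C) (col 1 C) = 0 ->
  cross (col 1 C) (col 2 C) = 0 -> cross (col 2 C) (col 0 C) = 0 ->
  forall i j, cross (col i C) (col j C) = 0.
Proof.
move=> c01 c12 c20; elim/ord3P; elim/ord3P;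
  by rewrite ?crossxx // crossN ?c01 ?c12 ?c20 oppr0.
Qed.

(** The coordinates of a cross product of columns are, up to sign, the minors
    on these two columns. *)
Lemma minors_cross0 C : (forall i j, cross (col i C) (col j C) = 0) ->
  forall i j k l, C k i * C l j = C l i * C k j.
Proof.
move=> c0 i j.
case: (crossE (col i C) (col j C)); rewrite c0 !mxE.
move=> /esym/subr0_eq e0 /esym/subr0_eq e1 /esym/subr0_eq e2.
by elim/ord3P; elim/ord3P.
Qed.

(** In the expansion of the determinant of (X - a) I - C in powers of X - a,
    the coefficient of degree 1 is the sum of the principal 2 x 2 minors of C
    and the constant one is - det C; the vanishing of the minors kills both. *)
Lemma char_poly_rank1 (A C : 'M[R]_3) a : A = C + a%:M ->
  (forall i j k l, C k i * C l j = C l i * C k j) ->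
  char_poly A = ('X - a%:P) ^+ 2 * ('X - (a + \tr C)%:P).
Proof.
move=> -> minC; have minP i j k l :
  (C k i)%:P * (C l j)%:P = (C l i)%:P * (C k j)%:P by rewrite -!polyCM minC.
rewrite /char_poly /mxtrace big_ord3 det3 !mxE /= !mulr1n !mulr0n !polyCD.
apply/subr0_eq.
pose minor i j k l := (C k i)%:P * (C l j)%:P - (C l i)%:P * (C k j)%:P.
have minor0 i j k l : minor i j k l = 0 by rewrite /minor minP subrr.
(* The first group is the coefficient of degree 1, the second one is the
   expansion of det C along its first row. *)
transitivity
  (('X - a%:P) * (minor 0 1 0 1 + minor 0 2 0 2 + minor 1 2 1 2)
   - ((C 0 0)%:P * minor 1 2 1 2 - (C 0 1)%:P * minor 0 2 1 2
      + (C 0 2)%:P * minor 0 1 1 2)); last by rewrite !minor0; ring.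
rewrite /minor; ring.
Qed.

End CrossProduct.

(** * Euclidean norm and orthonormal eigenbases *)

Section Euclidean.
Variable R : rcfType.
Implicit Types (x y z : 'cV[R]_3) (A C : 'M[R]_3) (s : seq 'cV[R]_3).

Lemma dotxx_ge0 x : 0 <= dot x x.
Proof. by apply: sumr_ge0 => i _; rewrite -expr2 sqr_ge0. Qed.

Lemma dotxx_eq0 x : (dot x x == 0) = (x == 0).
Proof.
apply/eqP/eqP => [|->]; last exact: dot0l.
move/eqP; rewrite psumr_eq0 => [/allP x0 | i _]; last by rewrite -expr2 sqr_ge0.
apply/matrixP => i j; rewrite (ord1 j) mxE; apply/eqP.
by have := x0 i (mem_index_enum i); rewrite mulf_eq0 orbb.
Qed.

Lemma enorm_normalize x : x != 0 -> enorm (normalize x) = 1.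
Proof.
move=> x0; have dx0 : dot x x != 0 by rewrite dotxx_eq0.
rewrite {1}/enorm /normalize dotZl dotZr mulrA -expr2 exprVn.
by rewrite sqr_sqrtr ?dotxx_ge0 // mulVf // sqrtr1.
Qed.

(** The orthogonal projection on the line of y, without square roots; for
    y = 0 both sides are 0. *)
Lemma normalize_proj x y :
  dot x (normalize y) *: normalize y = (dot x y / dot y y) *: y.
Proof.
rewrite /normalize dotZr scalerA mulrAC -expr2 exprVn mulrC.
by rewrite sqr_sqrtr ?dotxx_ge0.
Qed.

Lemma mem_leigenspace A a x :
  (x \in leigenspace (mxend A) a) = ((A - a%:M) *m x == 0).
Proof.
rewrite /leigenspace memv_ker add_lfunE opp_lfunE scale_lfunE id_lfunE lfunE /=.
by rewrite mulmxBl mul_scalar_mx.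
Qed.

(** Turns the three conditions on an eigenbasis into computations with dot:
    spanning follows once every kernel vector equals its Fourier expansion. *)
Lemma fourier_eigenbasis A a s : Defs.orthonormal s ->
  (forall x, x \in s -> (A - a%:M) *m x = 0) ->
  (forall x, (A - a%:M) *m x = 0 -> x = \sum_(v <- s) dot x v *: v) ->
  orthonormal_eigenbasis A a s.
Proof.
move=> on_s ker_s exp_s; split=> // [x xs|].
  split.
    have /allP/(_ x xs) := proj1 (andP on_s).
    by apply: contraTneq => ->; rewrite /enorm dot0l sqrtr0 eq_sym oner_eq0.
  exists a; apply/eqP; rewrite -subr_eq0 -mul_scalar_mx -mulmxBl.
  by rewrite ker_s.
apply/eqP; rewrite eqEsubv; apply/andP; split.
  by apply/span_subvP => x xs; rewrite mem_leigenspace ker_s.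
apply/subvP => x; rewrite mem_leigenspace => /eqP/exp_s ->.
by rewrite big_seq; apply: memv_suml => v vs; rewrite memvZ ?memv_span.
Qed.

(** A kernel vector x is orthogonal to both columns, hence parallel to their
    cross product v by the triple product formula.  Applied to a nonzero x, this
    puts v in the kernel; applied to an arbitrary one, it shows that v spans. *)
Lemma eigenbasis_cross A a i j : let C := A - a%:M in
  C^T = C -> leigenvalue (mxend A) a -> cross (col i C) (col j C) != 0 ->
  orthonormal_eigenbasis A a [:: normalize (cross (col i C) (col j C))].
Proof.
move=> C symC; rewrite /leigenvalue -vpick0; set x := vpick _ => x_neq0 v_neq0.
have : x \in leigenspace (mxend A) a by apply: memv_pick.
rewrite mem_leigenspace -/C => /eqP kerx.
set v := cross _ _ in v_neq0 *.
have ker_parallel y : C *m y = 0 -> cross y v = 0.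
  move=> /(sym_ker_dotP _ symC) y0.
  by rewrite /v triple_cross !(dotC y) !y0 !scale0r subr0.
have kerv : C *m v = 0.
  have := parallel_cross0 (ker_parallel _ kerx).
  have vx : dot x x *: v = dot x v *: x.
    apply: parallel_cross0; rewrite crossN; apply/eqP; rewrite oppr_eq0.
    exact/eqP/ker_parallel.
  have : dot x x *: (C *m v) = 0 by rewrite scalemxAr vx -scalemxAr kerx scaler0.
  by move/eqP; rewrite scaler_eq0 dotxx_eq0 (negPf x_neq0) => /eqP.
apply: fourier_eigenbasis => [|y|y /ker_parallel/parallel_cross0 yv].
- by rewrite /Defs.orthonormal /= enorm_normalize ?eqxx.
- by rewrite inE => /eqP ->; rewrite -scalemxAr kerv scaler0.
rewrite big_seq1 normalize_proj dotC mulrC -scalerA -yv scalerA mulVf ?scale1r //.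
by rewrite dotxx_eq0.
Qed.

(** A nonzero vector is nonzero at a coordinate k of largest modulus.  Since the
    other factor w is 0 at k and 1 elsewhere, some coordinate of cross x w equals x_k up to sign. *)
Lemma cross_argmax_neq0 x k : x != 0 ->
  (forall j, `|x j 0| <= `|x k 0|) ->
  cross x (\col_i (if i == k then 0 else 1)) != 0.
Proof.
move=> x_neq0 maxk; set w := \col_i _.
have xk_neq0 : x k 0 != 0.
  apply: contraNneq x_neq0 => xk0; apply/eqP/matrixP => i j.
  rewrite (ord1 j) mxE; apply/eqP.
  by rewrite -normr_le0 -[leRHS](normr0 R) -xk0 maxk.
apply: contra_neq xk_neq0 => /esym xw0.
case: (crossE x w); rewrite -xw0 !mxE /w.
elim/ord3P: k {maxk w xw0} => /=; rewrite ?(mulr1, mulr0, sub0r, subr0).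
- by move=> _ ->.
- by move=> _ _ /esym/eqP; rewrite oppr_eq0 => /eqP.
- by move=> ->.
Qed.

(** If the kernel is the plane orthogonal to x, any nonzero y in it is completed
    by cross y x to an orthogonal basis: x, y, cross y x are orthogonal and nonzero, so
    nothing but 0 is orthogonal to the three of them. *)
Lemma complement_eigenbasis A a x y : let C := A - a%:M in
  x != 0 -> y != 0 -> dot x y = 0 ->
  (forall z, C *m z = 0 <-> dot x z = 0) ->
  orthonormal_eigenbasis A a [:: normalize y; normalize (cross y x)].
Proof.
move=> C x_neq0 y_neq0 xy0 kerC.
have z_neq0 : cross y x != 0.
  by rewrite -dotxx_eq0 dot_cross_cross (dotC y x) xy0 expr0n subr0
             mulf_neq0 // dotxx_eq0.
have xz0 : dot x (cross y x) = 0 by apply: dot_crossr.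
have yz0 : dot y (cross y x) = 0 by apply: dot_crossl.
set z := cross y x in z_neq0 xz0 yz0 *.
have [dy_neq0 dz_neq0] : dot y y != 0 /\ dot z z != 0 by rewrite !dotxx_eq0.
apply: fourier_eigenbasis => [|t|t /kerC xt0].
- rewrite /Defs.orthonormal /= !enorm_normalize // /normalize dotZl dotZr yz0.
  by rewrite !mulr0 !eqxx.
- by rewrite !inE => /orP[] /eqP ->; apply/kerC; rewrite dotZr ?xy0 ?xz0 mulr0.
rewrite big_cons big_seq1 !normalize_proj.
(* The remainder r of the expansion of t is orthogonal to x and y, hence
   parallel to z = cross y x by the triple product; but it is orthogonal to z. *)
set t1 := _ *: y; set t2 := _ *: z; apply/eqP.
rewrite -subr_eq0 opprD addrA; set r := _ - _.
have rx0 : dot r x = 0.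
  by rewrite !dotBl !dotZl !(dotC _ x) xt0 xy0 xz0 !mulr0 !subr0.
have ry0 : dot r y = 0.
  by rewrite !dotBl !dotZl (dotC z) yz0 mulr0 subr0 divfK ?subrr.
have rz0 : dot z r = 0.
  by rewrite dotC !dotBl !dotZl yz0 mulr0 subr0 divfK ?subrr.
have /parallel_cross0/eqP : cross r z = 0.
  by rewrite /z triple_cross rx0 ry0 !scale0r subr0.
by rewrite rz0 scale0r scaler_eq0 (negPf dz_neq0).
Qed.

Lemma parallel_cols_ker C i x : C^T = C ->
  (forall i j, cross (col i C) (col j C) = 0) -> col i C != 0 ->
  C *m x = 0 <-> dot (col i C) x = 0.
Proof.
move=> symC c0 ci_neq0; rewrite (sym_ker_dotP _ symC); split=> [//|cix j].
have /(congr1 (fun y => dot y x)) := parallel_cross0 (c0 j i).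
by move/eqP; rewrite !dotZl cix mulr0 mulf_eq0 dotxx_eq0 (negPf ci_neq0) => /eqP.
Qed.

(** The minor condition and symmetry give C_ii C_jj = C_ij^2; summed over i and
    j, this says that (tr C)^2 is the sum of the squares of the entries of C. *)
Lemma trace_rank1_neq0 C : C^T = C ->
  (forall i j k l, C k i * C l j = C l i * C k j) -> C != 0 -> \tr C != 0.
Proof.
move=> symC minC; apply: contra_neq => trC0.
have Cji i j : C j i = C i j by rewrite -[in LHS]symC mxE.
have /eqP : \sum_i \sum_j C i j ^+ 2 = 0.
  transitivity (\tr C * \tr C); last by rewrite trC0 mulr0.
  rewrite /mxtrace mulr_suml; apply: eq_bigr => i _; rewrite mulr_sumr.
  by apply: eq_bigr => j _; rewrite minC Cji expr2.
rewrite psumr_eq0 => [/allP C0|i _]; last by apply: sumr_ge0 => j _; rewrite sqr_ge0.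
apply/matrixP => i j; rewrite mxE; have := C0 i (mem_index_enum i).
rewrite psumr_eq0 => [/allP/(_ j (mem_index_enum j))|k _]; last exact: sqr_ge0.
by rewrite expf_eq0 /= => /eqP.
Qed.

Lemma mup_char_poly_rank1 A a : let C := A - a%:M in C^T = C ->
  (forall i j k l, C k i * C l j = C l i * C k j) -> C != 0 ->
  mup a (char_poly A) = 2%N.
Proof.
move=> C symC minC C_neq0.
rewrite (@char_poly_rank1 _ A C a) ?subrK // mupMl ?mup_XsubCX ?eqxx //.
by rewrite root_XsubC -[X in X != _]addr0 (inj_eq (addrI a)) eq_sym trace_rank1_neq0.
Qed.

Lemma standard_eigenbasis A a : A - a%:M = 0 ->
  orthonormal_eigenbasis A a [:: col3 1 0 0; col3 0 1 0; col3 0 0 1].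
Proof.
move=> C0; apply: fourier_eigenbasis => [|x _|x _]; last 1 first.
- rewrite !big_cons big_nil !dotE !mxE /=.
  by apply: eq_cV3; rewrite !mxE /=; ring.
- by rewrite /Defs.orthonormal /= /enorm !dotE !mxE /=
             !(mulr0, mul0r, mulr1, addr0, add0r) sqrtr1 !eqxx.
by rewrite C0 mul0mx.
Qed.

End Euclidean.

(** * Eigenspaces of symmetric matrices from cross products *)

Theorem theorem4 (R : realType) (A : 'M[R]_3) (alpha : R)
    (A_sym : A^T = A) (alpha_eig : leigenvalue (mxend A) alpha) :
  let C := A - alpha%:M in
  let c1 := col 0 C in
  let c2 := col 1 C in
  let c3 := col 2 C in
  [/\ (* (i) *)
      C = 0 ->
      orthonormal_eigenbasis A alpha
        [:: col3 1 0 0; col3 0 1 0; col3 0 0 1] /\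
      leigenspace (mxend A) alpha = fullv,
      (* (ii) *)
      C <> 0 ->
      forall v : 'cV[R]_3,
        v \in [:: cross c1 c2; cross c2 c3; cross c3 c1] -> v <> 0 ->
        orthonormal_eigenbasis A alpha [:: normalize v]
    & (* (iii) *)
      C <> 0 ->
      cross c1 c2 = 0 -> cross c2 c3 = 0 -> cross c3 c1 = 0 ->
      forall u : 'cV[R]_3, u \in [:: c1; c2; c3] -> u <> 0 ->
      forall k : 'I_3, (forall j : 'I_3, `|u j 0| <= `|u k 0|) ->
      let w : 'cV[R]_3 := \col_(i < 3) (if i == k then 0 else 1) in
      let v1 := cross u w in
      let v2 := cross v1 u in
      orthonormal_eigenbasis A alpha [:: normalize v1; normalize v2] /\
      mup alpha (char_poly A) = 2%N].
Proof.
move=> C c1 c2 c3.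
have symC : C^T = C by rewrite /C linearB /= tr_scalar_mx A_sym.
split=> [C0 | _ v | /eqP C_neq0 c12 c23 c31 u u_col /eqP u_neq0 k maxk w v1 v2].
- split; first exact: standard_eigenbasis.
  by apply/vspaceP => x; rewrite mem_leigenspace -/C C0 mul0mx eqxx memvf.
- by rewrite !inE => /or3P[] /eqP -> /eqP v_neq0; apply: eigenbasis_cross.
have c0 := cross_cols0 c12 c23 c31.
split; last exact: mup_char_poly_rank1 symC (minors_cross0 c0) C_neq0.
have [i u_def] : exists i, u = col i C.
  by move: u_col; rewrite !inE => /or3P[] /eqP ->; [exists 0|exists 1|exists 2].
apply: complement_eigenbasis => //.
- exact: cross_argmax_neq0.
- exact: dot_crossl.
by move=> z; rewrite u_def; apply: parallel_cols_ker; rewrite // -u_def.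
Qed.
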